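(* There exists a coupling argument that shows that the random transposition walk on the symmetric group $S_n$ mixes in time of order $n\log n$: that is, it demonstrates that there exists a constant $C$ such that $$\tau_{\mathrm{mix}} \le C\, n\log n .$$
   Context: The random transposition walk on $S_n$ is the Markov chain in which, at each step, two elements $u,v\in\{1,\dots,n\}$ are chosen independently and uniformly at random and the current permutation is multiplied by the transposition $(u\,v)$ (by the identity if $u=v$). Its stationary distribution $\bar\pi$ is uniform on $S_n$; let $\bar P$ be its transition matrix. For probability distributions $\mu,\nu$ on a finite set $\Omega$, $\|\mu-\nu\|_{TV}=\frac12\sum_{x\in\Omega}|\mu(x)-\nu(x)|$. Put $d(t)=\max_{x\in S_n}\|\bar P^t(x,\cdot)-\bar\pi\|_{TV}$ and $\tau_{\mathrm{mix}}=\min\{t : d(t)\le 1/4\}$. The constant $C$ does not depend on $n$. A coupling of a pair of Markov chains both with transition matrix $Q$ is a process $(X_t,Y_t)_{t\ge0}$ such that both $(X_t)_{t\ge0}$ and $(Y_t)_{t\ge0}$ are Markov chains with transition matrix $Q$, possibly with different starting distributions. A coupling argument is one that bounds the mixing time by constructing couplings and controlling the time at which the two chains meet, for instance through the coupling inequality $d(t)\le\max_{x,y}\mathbb{P}\{T_{x,y}>t\}$, where $T_{x,y}$ is a random time at which the coupled chains started at $x$ and $y$ have met. *)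

(* Defs.v *)
From HB Require Import structures.
From mathcomp Require Import all_boot all_order all_algebra all_fingroup.
From mathcomp Require Import all_classical all_reals all_analysis.

Set Implicit Arguments.
Unset Strict Implicit.
Unset Printing Implicit Defensive.

Import Order.TTheory GRing.Theory Num.Theory.

Local Open Scope classical_set_scope.
Local Open Scope ring_scope.

Section FiniteChains.
Context {R : realType} {S : finType}.
Implicit Types (Q : S -> S -> R) (mu nu : S -> R).

Fixpoint kernel_pow Q (t : nat) (x y : S) : R :=
  if t is t'.+1 then \sum_(z : S) kernel_pow Q t' x z * Q z y
  else (x == y)%:R.

Definition tv_dist mu nu : R := 2%:R^-1 * \sum_(x : S) `|mu x - nu x|.

(* The neutral element 0 of the maximum is harmless: [tv_dist] is
   nonnegative. *)
Definition worst_tv Q pi (t : nat) : R :=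
  \big[Num.max/0]_(x : S) tv_dist (kernel_pow Q t x) pi.

Definition is_mixing_time Q pi (tau : nat) : Prop :=
  worst_tv Q pi tau <= 4%:R^-1 /\
  forall t : nat, worst_tv Q pi t <= 4%:R^-1 -> (tau <= t)%N.

Definition history {Omega : Type} (X : nat -> Omega -> S) (x : nat -> S)
    (t : nat) : set Omega :=
  [set w | forall s, (s <= t)%N -> X s w = x s].

(* P{X_(t+1) = y | X_0 = x_0, ..., X_t = x_t} = Q(x_t, y) for every history of
   positive probability; the initial distribution is unconstrained. *)
Definition markov_chain {d : measure_display} {Omega : measurableType d}
    (P : probability Omega R) Q (X : nat -> Omega -> S) : Prop :=
  (forall t y, measurable (X t @^-1` [set y])) /\
  forall (t : nat) (x : nat -> S) (y : S),
    (0 < P (history X x t))%E ->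
    fine (P (history X x t `&` X t.+1 @^-1` [set y])) / fine (P (history X x t))
      = Q (x t) y.

(* Only the two marginal processes are required to be Markov chains, the pair
   (X_t, Y_t) need not be one. *)
Record coupling (Q : S -> S -> R) := Coupling {
  cpl_disp : measure_display ;
  cpl_space : measurableType cpl_disp ;
  cpl_prob : probability cpl_space R ;
  cplX : nat -> cpl_space -> S ;
  cplY : nat -> cpl_space -> S ;
  cplX_chain : markov_chain cpl_prob Q cplX ;
  cplY_chain : markov_chain cpl_prob Q cplY }.

Arguments cplX [Q] c : rename.
Arguments cplY [Q] c : rename.
Arguments cpl_prob [Q] c : rename.

Definition started_at Q (K : coupling Q) (x y : S) : Prop :=
  cpl_prob K (cplX K 0%N @^-1` [set x]) = 1%E /\
  cpl_prob K (cplY K 0%N @^-1` [set y]) = 1%E.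

(* The event {T > t} for a random time T in {0, 1, 2, ...} + {infinity};
   [None] stands for infinity. *)
Definition after {Omega : Type} (T : Omega -> option nat) (t : nat) :
    set Omega :=
  [set w | if T w is Some s then (t < s)%N else true].

(* The chains have met at time T and agree from then on; without the latter
   requirement the coupling inequality could fail. *)
Definition meeting_time Q (K : coupling Q) (T : cpl_space K -> option nat) :
    Prop :=
  (forall t : nat, measurable (after T t)) /\
  forall w s t, T w = Some s -> (s <= t)%N -> cplX K t w = cplY K t w.

(* One coupling, on its own probability space, for each pair of starting
   points. *)
Record coupling_argument (Q : S -> S -> R) := CouplingArgument {
  arg_cpl : S -> S -> coupling Q ;
  arg_start : forall x y, started_at (arg_cpl x y) x y ;
  arg_time : forall x y, cpl_space (arg_cpl x y) -> option nat ;
  arg_meet : forall x y, meeting_time (@arg_time x y) }.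

Arguments arg_time [Q] c x y : rename.

(* max_(x, y) P{T_(x,y) > t} *)
Definition coupling_bound Q (A : coupling_argument Q) (t : nat) : R :=
  \big[Num.max/0]_(x : S) \big[Num.max/0]_(y : S)
    fine (cpl_prob (arg_cpl A x y) (after (arg_time A x y) t)).

End FiniteChains.

Section RandomTransposition.
Context (R : realType) (n : nat).

(* Probability that x * (u v) = y with u, v independent and uniform on 'I_n;
   [tperm u u] is the identity. *)
Definition transposition_kernel (x y : 'S_n) : R :=
  \sum_(u < n) \sum_(v < n) (y == (x * tperm u v)%g)%:R / (n ^ 2)%:R.

Definition uniform_perm (x : 'S_n) : R := #|{: 'S_n}|%:R^-1.

End RandomTransposition.

(* Main.v *)
(* Broder's strong uniform time is turned into a coupling. Cards are marked one
   after the other: a shuffle exchanging the cards u and v marks u when u is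
   unmarked and v is either marked or equal to u. Once all the cards are marked
   the arrangement is exactly uniform, and a supermartingale bound shows that
   O(n log n) shuffles mark all of them with probability at least 3/4. Hence
   for a suitable t0 of this order the sequences of t0 shuffles leading from x
   to z, and those leading from y to z, are both numerous enough, uniformly in
   z, for some permutation phi of the set of all sequences to match the end
   points of b (from x) and phi b (from y) for at least 3/4 of the sequences b.
   The coupling feeds the chain started at x with independent uniform
   transpositions, the chain started at y with the phi-image of the first t0 of
   them, and both chains with the same transpositions afterwards. *)
Require Import Defs.
From HB Require Import structures.
From mathcomp Require Import all_boot all_order all_algebra all_fingroup.
From mathcomp Require Import all_classical all_reals all_analysis.
From mathcomp Require Import ring lra.

Set Implicit Arguments.
Unset Strict Implicit.
Unset Printing Implicit Defensive.

Import Order.TTheory GRing.Theory Num.Theory.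
Local Open Scope ring_scope.

(** * The strong uniform time *)

Lemma sum_tuple_rcons (V : nmodType) (B : finType) (T : nat) (F : seq B -> V) :
  \sum_(b : T.+1.-tuple B) F b
    = \sum_(b : T.-tuple B) \sum_(c : B) F (rcons b c).
Proof.
rewrite pair_big /=.
rewrite (reindex (fun p : T.-tuple B * B => [tuple of rcons p.1 p.2])) //=.
apply/onW_bij/inj_card_bij => [[b c] [b' c'] /(congr1 val) /= /rcons_inj|].
  by case=> /val_inj-> ->.
by rewrite card_prod !card_tuple expnSr.
Qed.

Lemma sum_tuple0 (V : nmodType) (B : finType) (F : seq B -> V) :
  \sum_(b : 0.-tuple B) F b = F [::].
Proof. by rewrite (big_pred1 [tuple]) // => b; apply/esym/eqP; rewrite (tuple0 b). Qed.

Section StrongUniformTime.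
Variable n : nat.
Implicit Types (V : {set 'I_n}) (c : 'I_n * 'I_n) (h x z : 'S_n).

Definition shuffle x c : 'S_n := (x * tperm c.1 c.2)%g.

Definition marks V c := (c.1 \notin V) && (c.2 \in c.1 |: V).

Definition mark V c := if marks V c then c.1 |: V else V.

(** The last shuffle either marks nothing, or marks [c.1], and then the earlier set was [V'] without
    [c.1]. The cases exclude each other, so the indicators add up. *)
Lemma mark_eqE V V' c : (mark V c == V' :> {set 'I_n}) =
  ((V == V') && ~~ marks V' c
   + [&& c.1 \in V', c.2 \in V' & V == V' :\ c.1])%N :> nat.
Proof.
rewrite /mark; have [->|neqV] := eqVneq V V'.
  rewrite (_ : [&& _, _ & _] = false) ?addn0; last first.
    apply/negbTE; rewrite !negb_and; case: (boolP (c.1 \in V')) => //= cV.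
    by apply/orP; right; apply/eqP => /setP/(_ c.1); rewrite !inE cV eqxx.
  case: ifP => [/andP[cV _]|_]; last by rewrite eqxx.
  by case: eqP => // /setP/(_ c.1); rewrite !inE eqxx (negbTE cV).
rewrite add0n /marks; case: ifPn => [/andP[cV c2]|].
  congr nat_of_bool; apply/eqP/and3P => [<-|[c1V _ /eqP->]].
    by rewrite c2 finset.setU1K // !inE eqxx.
  by rewrite finset.setD1K.
rewrite (negbTE neqV) negb_and negbK => c12.
suff -> : [&& c.1 \in V', c.2 \in V' & V == V' :\ c.1] = false by [].
apply/negP => /and3P[c1 c2 /eqP Ve]; move: c12.
by rewrite Ve finset.setD1K // c2 !inE eqxx.
Qed.

(** Unnormalised joint law of the marked set and the arrangement after [t] shuffles; dividing by
    [(n ^ 2) ^ t] gives the probability. *)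
Definition marked_count V0 x t V z : nat :=
  (\sum_(b : t.-tuple ('I_n * 'I_n))
    ((foldl mark V0 b == V) && (foldl shuffle x b == z)))%N.

(** Condition on the last shuffle [c]: a transposition is an involution, so the arrangement before
    it was [shuffle z c]. The two sums separate the shuffles that mark nothing from those that mark
    [c.1]. *)
Lemma marked_countS V0 x t V z :
  marked_count V0 x t.+1 V z =
  (\sum_c ~~ marks V c * marked_count V0 x t V (shuffle z c)
   + \sum_c ((c.1 \in V) && (c.2 \in V))
       * marked_count V0 x t (V :\ c.1) (shuffle z c))%N.
Proof.
pose F b := ((foldl mark V0 b == V) && (foldl shuffle x b == z) : nat).
rewrite /marked_count (sum_tuple_rcons _ F) exchange_big /F /=.
rewrite -big_split /=; apply: eq_bigr => c _.
rewrite !big_distrr /= -big_split /=; apply: eq_bigr => b _.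
rewrite !foldl_rcons; move: (foldl mark V0 b) (foldl shuffle x b) => W y.
have -> : (shuffle y c == z) = (y == shuffle z c).
  by rewrite /shuffle; apply/eqP/eqP => [<-|->]; rewrite -mulgA tperm2 mulg1.
case: (y == _); last by rewrite !andbF !muln0.
rewrite !andbT mark_eqE; congr addn; first by rewrite mulnb andbC.
by rewrite mulnb -andbA.
Qed.

(* Broder's observation: given which cards are marked and where the marked
   and the unmarked cards lie, the arrangement of the marked cards is uniform. *)
Lemma marked_countM V0 x t V z h : (#|V0| <= 1)%N -> perm_on V h ->
  marked_count V0 x t V (z * h)%g = marked_count V0 x t V z.
Proof.
move=> V01; elim: t V z h => [|t IHt] V z h Vh.
  pose F y b := ((foldl mark V0 b == V) && (foldl shuffle x b == y) : nat).
  rewrite /marked_count (sum_tuple0 (F (z * h)%g)) (sum_tuple0 (F z)) /F /=.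
  (* Initially at most one card is marked, so [h] is the identity. *)
  case: eqP => //= VE; have V1 : (#|V| <= 1)%N by rewrite -VE.
  by rewrite (perm_on_id Vh V1) mulg1.
rewrite !marked_countS; congr addn.
  (* No card is marked: [h] preserves [V], so applying it to both entries of [c] permutes the
     non-marking shuffles, and [h] moves past the conjugated transposition. *)
  rewrite [LHS](reindex (fun c => (h c.1, h c.2))) /=; last first.
    exists (fun c => ((h^-1)%g c.1, (h^-1)%g c.2)) => -[u v] _ /=;
      by rewrite ?permK ?permKV.
  apply: eq_bigr => -[u v] _ /=; congr (nat_of_bool _ * _)%N.
    by rewrite /marks /= !inE !(perm_closed _ Vh) (inj_eq perm_inj).
  by rewrite /shuffle /= -mulgA -tpermJ -conjgC mulgA (IHt _ _ _ Vh).
pose G y u v := (((u \in V) && (v \in V))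
  * marked_count V0 x t (V :\ u) (y * tperm u v)%g)%N.
rewrite -(pair_bigA _ (G (z * h)%g)) -(pair_bigA _ (G z)) /G /=.
apply: eq_bigr => u _; case: (boolP (u \in V)) => [uV|_]; last first.
  by rewrite !big1 // => v _; rewrite mul0n.
(* The card [u] is marked: keep [u] and move only its partner [v] by [h]. *)
rewrite [LHS](reindex_perm h) /=; apply: eq_bigr => v _; rewrite (perm_closed _ Vh).
case: (boolP (v \in V)) => [vV|_]; last by rewrite !mul0n.
rewrite !mul1n /shuffle /=.
(* [k] sends [u] to [v], then to [h v], then back to [u]; it is supported in [V] and fixes [u], so
   induction applies to [V :\ u]. *)
pose k := (tperm u v * h * tperm u (h v))%g.
have -> : (z * h * tperm u (h v) = z * tperm u v * k)%g.
  by rewrite /k !mulgA -(mulgA z (tperm u v) (tperm u v)) tperm2 mulg1.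
have pV w : w \in V -> perm_on V (tperm u w).
  move=> wV; apply: fintype.subset_trans (tperm_on u w) _.
  by apply/fintype.subsetP => y; rewrite !inE => /orP[]/eqP->.
apply: IHt; apply/fintype.subsetP => y; rewrite inE => ky.
rewrite !inE; apply/andP; split.
  by apply: contraNneq ky => ->; rewrite /k !permM tpermL tpermR.
have kV : perm_on V k by rewrite !perm_onM // pV // perm_closed.
by apply: contraR ky => yV; rewrite (out_perm kV).
Qed.

(** Every permutation is supported in the full set, so the count does not depend on [z]; summing it
    over all arrangements yields every fully marking sequence once. *)
Lemma marked_count_full V0 x t z : (#|V0| <= 1)%N ->
  (marked_count V0 x t [set: 'I_n] z * #|{: 'S_n}| =
    \sum_(b : t.-tuple ('I_n * 'I_n)) (foldl mark V0 b == [set: 'I_n]))%N.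
Proof.
move=> V01; rewrite mulnC -sum_nat_const.
rewrite (eq_bigr (marked_count V0 x t [set: 'I_n])) => [|w _]; last first.
  rewrite -(@marked_countM V0 x t _ w (w^-1 * z)%g V01) ?mulKVg //.
  by apply/fintype.subsetP => ?; rewrite inE.
rewrite /marked_count exchange_big /=; apply: eq_bigr => b _.
case: eqP => _ /=; last by rewrite big1.
rewrite (bigD1 (foldl shuffle x b)) //= eqxx big1 // => w.
by rewrite eq_sym => /negbTE->.
Qed.
End StrongUniformTime.

Arguments shuffle {n} x c.
Arguments mark {n} V c.

(** * The expected time until all cards are marked *)

Section MarkingTime.
Variables (R : realType) (n : nat).
Implicit Types (V : {set 'I_n}).

(* The expected time still needed when k labels are marked: the next label is
   marked with probability (k + 1)(n - k) / n^2. *)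
Definition marking_potential (k : nat) : R :=
  \sum_(k <= i < n) (n ^ 2)%:R / (i.+1 * (n - i))%:R.

Lemma marking_potential_ge0 k : 0 <= marking_potential k.
Proof. by apply: sumr_ge0 => i _; rewrite divr_ge0. Qed.

Lemma card_marks V : (\sum_c marks V c = #|V|.+1 * (n - #|V|))%N.
Proof.
rewrite -(pair_bigA _ (fun u v => nat_of_bool (marks V (u, v)))) /=.
rewrite (eq_bigr (fun u => (u \notin V) * #|V|.+1)%N) => [|u _]; last first.
  rewrite /marks /=; case: (boolP (u \in V)) => uV; first by rewrite big1.
  by rewrite -big_mkcond sum1_card cardsU1 uV mul1n.
rewrite -big_distrl mulnC /=; congr (_ * _)%N.
have -> : (n - #|V| = #|~: V|)%N by rewrite [RHS]cardsCs finset.setCK card_ord.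
rewrite -sum1_card [RHS]big_mkcond /=.
by apply: eq_bigr => u _; rewrite !inE; case: (_ \in _).
Qed.

(** Marking a card lowers the potential by the inverse of the probability of marking one, so the
    mean drop per shuffle is exactly 1 until all cards are marked. *)
Lemma marking_potential_mean V :
  \sum_c marking_potential #|mark V c|
    = (n ^ 2)%:R * (marking_potential #|V| - (V != [set: 'I_n])%:R).
Proof.
have [->|VT] := eqVneq V [set: 'I_n].
  rewrite subr0 (eq_bigr (fun=> 0)) => [|c _].
    by rewrite sumr_const mul0rn /marking_potential cardsT card_ord big_geq ?mulr0.
  rewrite /mark /marks inE /= /marking_potential cardsT card_ord big_geq //.
have Vn : (#|V| < n)%N.
  by have := max_card (mem V); rewrite card_ord ltn_neqAle => ->; rewrite andbT;
    apply: contraNneq VT => e; rewrite eqEcard finset.subsetT cardsT card_ord e /=.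
pose g : R := (n ^ 2)%:R / (#|V|.+1 * (n - #|V|))%:R.
rewrite (eq_bigr (fun c => marking_potential #|V| - (marks V c)%:R * g)) => [|c _].
  rewrite sumrB sumr_const card_prod !card_ord mulnn mulrBr mulr1 -[in LHS]mulr_natl.
  rewrite -mulr_suml -natr_sum card_marks /g [in LHS](mulrC _%:R (_ / _)) divfK //.
  by rewrite pnatr_eq0 muln_eq0 /= subn_eq0 -ltnNge.
rewrite /mark; case: ifPn => [|_]; last by rewrite mul0r subr0.
case/andP=> cV _; rewrite cardsU1 cV add1n mul1r /marking_potential.
by rewrite [X in _ = X - _]big_ltn // addrC addKr.
Qed.

(** The nonnegative potential loses in mean the probability that marking is incomplete. This
    probability decreases in time, so [t] times its last value is at most the initial potential. *)
Lemma unmarked_count_le V t :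
  t%:R * (\sum_(b : t.-tuple ('I_n * 'I_n)) (foldl mark V b != [set: 'I_n]))%N%:R
    <= (n ^ 2)%:R ^+ t * marking_potential #|V|.
Proof.
pose p t := (\sum_(b : t.-tuple ('I_n * 'I_n)) (foldl mark V b != [set: 'I_n]))%N.
pose A t := \sum_(b : t.-tuple ('I_n * 'I_n)) marking_potential #|foldl mark V b|.
have AS s : A s.+1 = (n ^ 2)%:R * (A s - (p s)%:R).
  rewrite /A (sum_tuple_rcons _ (fun b => marking_potential #|foldl mark V b|)).
  rewrite /p natr_sum -sumrB mulr_sumr; apply: eq_bigr => b _.
  rewrite -marking_potential_mean; apply: eq_bigr => c _.
  by rewrite foldl_rcons.
have pS s : (p s.+1 <= n ^ 2 * p s)%N.
  rewrite /p (sum_tuple_rcons _ (fun b => foldl mark V b != [set: 'I_n] : nat)).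
  rewrite big_distrr leq_sum //= => b _.
  apply: (@leq_trans (\sum_(c : 'I_n * 'I_n) (foldl mark V b != [set: 'I_n]))%N).
    apply: leq_sum => c _; rewrite foldl_rcons; case: eqP => //= ne.
    by case: eqP => // e; case: ne; rewrite e /mark /marks inE.
  by rewrite sum_nat_const card_prod !card_ord mulnn.
have A0 s : 0 <= A s by apply: sumr_ge0 => b _; exact: marking_potential_ge0.
(* Keeping the remaining potential [A t] on the left makes the induction work: its drop pays for one
   more copy of [p t]. *)
suff : A t + t%:R * (p t)%:R <= (n ^ 2)%:R ^+ t * marking_potential #|V|.
  by apply: le_trans; rewrite lerDr.
elim: t => [|t IHt].
  by rewrite mul0r addr0 expr0 mul1r /A
    (sum_tuple0 (fun b => marking_potential #|foldl mark V b|)).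
rewrite exprS -mulrA; apply: le_trans (ler_wpM2l (ler0n _ _) IHt).
rewrite AS mulrBr mulrDr -addrA lerD2l.
apply: (@le_trans _ _ (- ((n ^ 2)%:R * (p t)%:R) + t.+1%:R * ((n ^ 2)%:R * (p t)%:R))).
  by rewrite lerD2l ler_wpM2l // -natrM ler_nat.
by rewrite -natr1; lra.
Qed.

Lemma harmonic_le_ln (m : nat) :
  \sum_(0 <= i < m.+1) (i.+1%:R : R)^-1 <= 1 + ln m.+1%:R.
Proof.
elim: m => [|m IHm]; first by rewrite big_nat1 ln1 addr0 invr1.
rewrite big_nat_recr //=.
have e : m.+1%:R / m.+2%:R = 1 - m.+2%:R^-1 :> R.
  by rewrite -[m.+1%:R](addrK 1) natr1 mulrBl divff ?mul1r ?pnatr_eq0.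
have : ln (m.+1%:R / m.+2%:R) <= - m.+2%:R^-1 :> R.
  rewrite e; apply: le_ln1Dx; rewrite ltrN2 invf_lt1 ?ltr0n //.
  by rewrite (ltr_nat R 1).
rewrite lnM ?lnV ?posrE ?invr_gt0 ?ltr0n // => h.
apply: le_trans (lerD IHm (lexx _)) _; move: h.
by move: (ln _) (ln _) (_^-1) => u v w; lra.
Qed.

(** Partial fractions: with [a = i + 1] and [b = n - i], [a + b = n + 1], hence [n ^ 2 / (a * b)] is
    at most [n * (1 / a + 1 / b)]. Both halves sum to a harmonic number. *)
Lemma marking_potential_le : (0 < n)%N ->
  marking_potential 1 <= 2 * n%:R * (1 + ln n%:R).
Proof.
move=> n0; apply: (@le_trans _ _ (marking_potential 0)).
  by rewrite [leRHS]/marking_potential big_ltn // lerDr divr_ge0.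
have H : \sum_(0 <= i < n) (i.+1%:R : R)^-1 <= 1 + ln n%:R.
  by rewrite -(prednK n0) harmonic_le_ln.
apply: (@le_trans _ _ (n%:R * (\sum_(0 <= i < n) (i.+1%:R)^-1
    + \sum_(0 <= i < n) (i.+1%:R)^-1))); last first.
  by rewrite -mulrA mulrCA ler_wpM2l // mulrDl mul1r lerD.
rewrite [X in _ + X]big_nat_rev /= -big_split mulr_sumr /=.
apply: ler_sum_nat => i /andP[_ ltin]; rewrite add0n -subSn // subSS.
have a0 : 0 < i.+1%:R :> R by rewrite ltr0n.
have b0 : 0 < (n - i)%:R :> R by rewrite ltr0n subn_gt0.
have ab : n%:R + 1 = i.+1%:R + (n - i)%:R :> R.
  by rewrite natr1 -natrD addSn subnKC // ltnW.
rewrite natrM natrX; move: ab; set a := i.+1%:R; set b := (n - i)%:R => ab.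
rewrite ler_pdivrMr ?mulr_gt0 //.
have -> : n%:R * (a^-1 + b^-1) * (a * b) = n%:R * (n%:R + 1) :> R.
  by rewrite ab; field; rewrite !gt_eqF.
by rewrite expr2 ler_wpM2l // lerDl.
Qed.

Lemma full_marking_time (i : 'I_n) : exists t : nat,
  t%:R <= 26 * n%:R * ln n%:R :> R /\
  (4 * \sum_(b : t.-tuple ('I_n * 'I_n)) (foldl mark [set i] b != [set: 'I_n])
     <= (n ^ 2) ^ t)%N.
Proof.
(* For [n = 1] the bound is 0, which allows only [t = 0]; the only card is marked from the start. *)
have [n1|n1] := leqP n 1.
  exists 0%N; split.
    by rewrite mulr_ge0 ?mulr_ge0 // ln_ge0 // (ler_nat R 1) (leq_trans _ (ltn_ord i)).
  rewrite (sum_tuple0 (fun b => foldl mark [set i] b != [set: 'I_n] : nat)) /=.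
  by rewrite eqEcard finset.subsetT cardsT card_ord cards1 n1.
(* [t] exceeds four times the initial potential, so marking is incomplete with probability at most
   1/4. *)
pose t := (Num.truncn (4 * marking_potential 1)).+1; exists t.
have n0 : (0 < n)%N by exact: ltnW.
have f0 := marking_potential_ge0 1.
split.
  (* Origin of 26: [t] is at most [8 n (1 + ln n) + 1], hence at most [9 n + 8 n ln n], and
     [1 <= 2 ln n] turns [9 n] into [18 n ln n]. *)
  have ln2 : 1 <= 2 * ln n%:R :> R.
    apply: (@le_trans _ _ (2 * ln 2 : R)); last first.
      by rewrite ler_wpM2l // ler_ln ?posrE ?ltr0n // ler_nat.
    have : ln (1 + - 2^-1) <= - 2^-1 :> R by apply: le_ln1Dx; lra.
    rewrite (_ : 1 + - 2^-1 = 2^-1 :> R); last by lra.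
    by rewrite lnV ?posrE //; lra.
  have : (Num.truncn (4 * marking_potential 1))%:R <= 4 * marking_potential 1.
    by rewrite truncn_le mulr_ge0.
  have := marking_potential_le n0.
  have nR : 1 <= n%:R :> R by rewrite (ler_nat R 1).
  have nln : n%:R * 1 <= n%:R * (2 * ln n%:R) :> R by rewrite ler_wpM2l.
  by rewrite /t -natr1; nra.
rewrite -(ler_nat R) natrM -(@ler_pM2l _ t%:R) ?ltr0n // mulrCA.
apply: (@le_trans _ _ (4 * ((n ^ 2)%:R ^+ t * marking_potential #|[set i]|))).
  by rewrite ler_wpM2l // unmarked_count_le.
rewrite cards1 (natrX _ (n ^ 2) t) mulrCA [leRHS]mulrC ler_wpM2l ?exprn_ge0 //.
by rewrite ltW // truncnS_gt.
Qed.

End MarkingTime.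

(** * Matching the end points of shuffle sequences *)

Lemma sum_nat_of_bool (A : finType) (P : pred A) :
  (\sum_a P a)%N = #|[pred a | P a]|.
Proof.
rewrite -sum1_card [RHS]big_mkcond; apply: eq_bigr => a _.
by rewrite inE; case: (P a).
Qed.

(* A permutation maximizing the number of agreements is optimal over every
   value at once: otherwise exchanging the images of two disagreeing points
   would create one more agreement. *)
Lemma matching_perm (A G : finType) (f g : A -> G) (m : nat) :
  (forall z, m <= \sum_a (f a == z))%N -> (forall z, m <= \sum_a (g a == z))%N ->
  exists phi : {perm A}, (m * #|G| <= \sum_a (f a == g (phi a)))%N.
Proof.
move=> fm gm; pose M (phi : {perm A}) := #|[pred a | f a == g (phi a)]|.
have [phi _ phi_max] := @arg_maxnP _ 1%g xpredT M isT; exists phi.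
suff mz z : (m <= \sum_a ((f a == z) && (g (phi a) == z)))%N.
  apply: (@leq_trans (\sum_z \sum_a ((f a == z) && (g (phi a) == z)))).
    by rewrite mulnC -sum_nat_const leq_sum.
  rewrite exchange_big leq_sum //= => a _.
  rewrite (bigD1 (f a)) //= eqxx /= [f a == g _]eq_sym big1 ?addn0 // => z.
  by rewrite [z == _]eq_sym => /negbTE->.
rewrite leqNgt; apply/negP => ltm.
(* [f] takes the value [z] at least [m] times but there are fewer than [m] agreements at [z], so one
   of these points disagrees; symmetrically for [g] below. *)
have [a fa ga] : exists2 a, f a == z & g (phi a) != z.
  apply/exists_inP; apply: contraLR ltm; rewrite negb_exists_in -leqNgt => /forall_inP h.
  apply: (leq_trans (fm z)); apply: leq_sum => a _.
  by case: (boolP (f a == z)) => //= /h; rewrite negbK => ->.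
have [b gb fb] : exists2 b, g (phi b) == z & f b != z.
  apply/exists_inP; apply: contraLR ltm; rewrite negb_exists_in -leqNgt => /forall_inP h.
  apply: (leq_trans (gm z)); rewrite (reindex_perm phi) /=; apply: leq_sum => b _.
  by case: (boolP (g (phi b) == z)) => //= /h; rewrite negbK => ->.
have := phi_max (tperm a b * phi)%g isT; apply/negP; rewrite -ltnNge.
apply: proper_card; apply/properP; split; last first.
  exists a; rewrite !inE ?permM ?tpermL ?(eqP fa) ?(eqP gb) //.
  by rewrite eq_sym.
apply/fintype.subsetP => c; rewrite !inE permM => /eqP fc.
rewrite tpermD ?fc //; apply: contraTneq isT => e; subst c.
- by case/negP: ga; rewrite -fc.
- by case/negP: fb; rewrite fc.
Qed.

(** Restricted to fully marking sequences, the number of ways to reach [z] is the same for all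
    starts and all [z]. Taking it as [m] in [matching_perm] gives at least as many agreements as
    fully marking sequences. *)
Lemma shuffle_matching (n t : nat) (i : 'I_n) (x y : 'S_n) :
  exists phi : {perm t.-tuple ('I_n * 'I_n)},
    (\sum_(b : t.-tuple ('I_n * 'I_n)) (foldl shuffle x b != foldl shuffle y (phi b))
       <= \sum_(b : t.-tuple ('I_n * 'I_n)) (foldl mark [set i] b != [set: 'I_n]))%N.
Proof.
have i1 : (#|[set i]| <= 1)%N by rewrite cards1.
have S0 : (0 < #|{: 'S_n}|)%N by apply/card_gt0P; exists 1%g.
pose m := marked_count [set i] x t [set: 'I_n] 1%g.
have le x' z : (m <= \sum_(b : t.-tuple ('I_n * 'I_n)) (foldl shuffle x' b == z))%N.
  have -> : m = marked_count [set i] x' t [set: 'I_n] z.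
    by apply/eqP; rewrite -(eqn_pmul2r S0) !marked_count_full.
  by apply: leq_sum => b _; case: eqP => //= _; case: eqP.
have [phi] := matching_perm (le x) (le y); exists phi.
have N P : (\sum_(b : t.-tuple ('I_n * 'I_n)) ~~ P b =
    #|{: t.-tuple ('I_n * 'I_n)}| - \sum_(b : t.-tuple ('I_n * 'I_n)) P b)%N.
  by rewrite !sum_nat_of_bool -[in RHS](cardC [pred a | P a]) addKn.
by rewrite !N -(marked_count_full x t 1%g i1); apply: leq_sub2l.
Qed.

(** * Total variation for chains driven by uniform innovations *)

Section RandomMapping.
Variables (R : realType) (S B : finType) (step : S -> B -> S).
Variable Q : S -> S -> R.
Hypothesis QE : forall x y, Q x y = (\sum_c (step x c == y))%N%:R / #|B|%:R.

Lemma kernel_pow_count t x z : kernel_pow Q t x z =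
  (\sum_(b : t.-tuple B) (foldl step x b == z))%N%:R / (#|B| ^ t)%:R.
Proof.
elim: t z => [|t IHt] z /=.
  by rewrite (sum_tuple0 (fun b => foldl step x b == z : nat)) divr1.
rewrite (sum_tuple_rcons _ (fun b => foldl step x b == z : nat)).
under eq_bigr do rewrite IHt QE mulf_div -natrM -natrM -expnSr.
rewrite -mulr_suml -natr_sum; congr (_%:R / _).
under eq_bigr do rewrite big_distrl /=.
rewrite exchange_big /=; apply: eq_bigr => b _.
rewrite (bigD1 (foldl step x b)) //= eqxx mul1n [X in (_ + X)%N]big1 => [|y].
  by rewrite addn0; apply: eq_bigr => c _; rewrite foldl_rcons.
by rewrite eq_sym => /negbTE->; rewrite mul0n.
Qed.

(** Reindex the sequences from [y] by [phi]: agreeing pairs cancel, and each disagreeing pair adds 2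
    to the sum of absolute values, which the factor 1/2 offsets. *)
Lemma tv_dist_kernel_pow_le t (phi : {perm t.-tuple B}) x y :
  tv_dist (kernel_pow Q t x) (kernel_pow Q t y) <=
    (\sum_(b : t.-tuple B) (foldl step x b != foldl step y (phi b)))%N%:R / (#|B| ^ t)%:R.
Proof.
rewrite /tv_dist ler_pdivrMl //.
rewrite (eq_bigr (fun z => `|\sum_(b : t.-tuple B)
    ((foldl step x b == z)%:R - (foldl step y (phi b) == z)%:R)|
    / (#|B| ^ t)%:R)) => [|z _]; last first.
  rewrite !kernel_pow_count [X in _ - X%:R / _](reindex_perm phi) /=.
  by rewrite !natr_sum -mulrBl -sumrB normrM [`|_^-1|]ger0_norm ?invr_ge0.
rewrite -mulr_suml mulrA ler_wpM2r ?invr_ge0 //.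
apply: (@le_trans _ _ (\sum_z \sum_(b : t.-tuple B)
    `|(foldl step x b == z)%:R - (foldl step y (phi b) == z)%:R|)).
  by apply: ler_sum => z _; apply: ler_norm_sum.
rewrite exchange_big natr_sum mulr_sumr; apply: ler_sum => b _ /=.
have [->|ne] := eqVneq; first by rewrite big1 ?mulr0 // => z _; rewrite subrr normr0.
have ne' := ne; rewrite eq_sym in ne'.
rewrite (bigD1 (foldl step x b)) //= (bigD1 (foldl step y (phi b))) //= big1.
  by rewrite !eqxx (negbTE ne) (negbTE ne') subr0 sub0r normrN !normr1 addr0 mulr1.
move=> z /andP[zx zy]; rewrite [foldl step x b == z]eq_sym (negbTE zx).
by rewrite eq_sym (negbTE zy) subrr normr0.
Qed.

(** A kernel whose rows sum to 1 contracts the sum of absolute values. *)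
Lemma tv_dist_kernel_powS t x y : (0 < #|B|)%N ->
  tv_dist (kernel_pow Q t.+1 x) (kernel_pow Q t.+1 y)
    <= tv_dist (kernel_pow Q t x) (kernel_pow Q t y).
Proof.
move=> B0; rewrite /tv_dist ler_wpM2l ?invr_ge0 //=.
apply: (@le_trans _ _ (\sum_z \sum_w
    `|kernel_pow Q t x w - kernel_pow Q t y w| * Q w z)).
  apply: ler_sum => z _; rewrite -sumrB; apply: le_trans (ler_norm_sum _ _ _) _.
  apply: ler_sum => w _; rewrite -mulrBl normrM [`|Q w z|]ger0_norm //.
  by rewrite QE divr_ge0.
rewrite exchange_big ler_sum //= => w _; rewrite -mulr_sumr.
under eq_bigr do rewrite QE.
rewrite -mulr_suml -natr_sum exchange_big /= (eq_bigr (fun=> 1%N)) => [|c _].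
  by rewrite sum1_card divff ?mulr1 // pnatr_eq0 -lt0n.
rewrite (bigD1 (step w c)) //= eqxx big1 // => z.
by rewrite eq_sym => /negbTE->.
Qed.

Lemma tv_dist_kernel_pow_antitone s t x y : (0 < #|B|)%N -> (s <= t)%N ->
  tv_dist (kernel_pow Q t x) (kernel_pow Q t y)
    <= tv_dist (kernel_pow Q s x) (kernel_pow Q s y).
Proof.
move=> B0 /subnK <-; elim: (t - s)%N => // k IHk.
by rewrite addSn; apply: le_trans IHk; apply: tv_dist_kernel_powS.
Qed.

(** Each innovation sequence acts bijectively on the states, so exactly one start leads to [z]: the
    kernel is doubly stochastic. *)
Lemma sum_kernel_pow_col t z : (0 < #|B|)%N ->
  (forall c, injective (step^~ c)) -> \sum_x kernel_pow Q t x z = 1.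
Proof.
move=> B0 injs; under eq_bigr do rewrite kernel_pow_count.
rewrite -mulr_suml -natr_sum exchange_big /= (eq_bigr (fun=> 1%N)) => [|b _].
  by rewrite sum1_card card_tuple divff // pnatr_eq0 -lt0n expn_gt0 B0.
have injb : injective (fun x => foldl step x b).
  by elim: (tval b) => [|c s IHs] x y //= /IHs /injs.
have [g _ gK] := injF_bij injb.
have e : foldl step (g z) b = z by exact: gK.
rewrite (bigD1 (g z)) //= e eqxx big1 // => x xz.
case: eqP => // fx; case/eqP: xz; apply: injb.
by rewrite e fx.
Qed.

End RandomMapping.

(** Column sums 1 make the uniform law the average of the rows [P y]; total variation is convex. *)
Lemma tv_dist_uniform_le (R : realType) (S : finType) (P : S -> S -> R) (x : S) (e : R) :
  (forall z, \sum_y P y z = 1) -> (forall y, tv_dist (P x) (P y) <= e) ->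
  tv_dist (P x) (fun=> #|S|%:R^-1) <= e.
Proof.
move=> P1 Pe; have S0 : 0 < #|S|%:R :> R by rewrite ltr0n; apply/card_gt0P; exists x.
rewrite -(ler_pM2l S0); apply: (@le_trans _ _ (\sum_y tv_dist (P x) (P y))).
  rewrite /tv_dist mulrCA -mulr_sumr ler_wpM2l ?invr_ge0 //.
  rewrite exchange_big mulr_sumr; apply: ler_sum => z _ /=.
  rewrite -[X in X * _]ger0_norm ?(ltW S0) // -normrM mulrBr divff ?gt_eqF //.
  rewrite -[X in _ - X](P1 z) mulr_natl -sumr_const -sumrB; exact: ler_norm_sum.
by rewrite mulr_natl -sumr_const; apply: ler_sum.
Qed.

(** * Independent uniform innovations *)

Section IidUniform.
Local Open Scope classical_set_scope.
Context {R : realType} {d : measure_display} {Omega : measurableType d}.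
Variables (P : probability Omega R) (B : finType).
Implicit Types (U : nat -> Omega -> B) (w : Omega).

Definition prefix U T w : T.-tuple B :=
  @Tuple T B (mkseq (U^~ w) T) (introT eqP (size_mkseq _ T)).

Arguments prefix : simpl never.

(** Independence and uniformity at once: every block of initial values is uniform over the tuples of
    its length. *)
Definition iid_uniform U := forall T (b : T.-tuple B),
  measurable [set w | prefix U T w = b] /\
  P [set w | prefix U T w = b] = ((#|B| ^ T)%:R^-1)%:E.

Lemma prefix_event U T (E : pred (T.-tuple B)) : iid_uniform U ->
  measurable [set w | E (prefix U T w)] /\
  P [set w | E (prefix U T w)] = ((\sum_b E b)%N%:R / (#|B| ^ T)%:R)%:E.
Proof.
move=> iidU; pose D := [set b : T.-tuple B | E b].
pose F (b : T.-tuple B) := [set w | prefix U T w = b].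
have -> : [set w | E (prefix U T w)] = \bigcup_(b in D) F b.
  apply/seteqP; split => [w Ew|w [b Eb wb]]; first by exists (prefix U T w).
  by move: Eb; have <- : prefix U T w = b := wb.
have mF b : D b -> measurable (F b) by move=> _; exact: (iidU T b).1.
split; first by apply: fin_bigcup_measurable => //; exact: finite_finset.
rewrite measure_fin_bigcup //; last 2 first.
- exact: finite_finset.
- by move=> b c _ _ [w [<- <-]].
rewrite (fsbigE [seq b : T.-tuple B <- index_enum (T.-tuple B) | E b]); last 3 first.
- by rewrite filter_uniq // index_enum_uniq.
- by move=> b /=; rewrite mem_filter => /andP[].
- by move=> b Eb; rewrite mem_filter Eb mem_index_enum.
rewrite big_filter_cond /= (eq_bigl (fun b : T.-tuple B => E b)) => [|b]; last first.
  by case: (boolP (E b)) => //= Eb; apply/mem_set.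
rewrite (eq_bigr (fun=> ((#|B| ^ T)%:R^-1)%:E)) => [|b _]; last exact: (iidU T b).2.
rewrite sumEFin big_mkcond natr_sum mulr_suml; congr (_%:E).
by apply: eq_bigr => b _; case: (E b); rewrite ?mul1r ?mul0r.
Qed.

End IidUniform.

Arguments prefix {d Omega B} U T w : simpl never.

(** * Independent innovations drive a Markov chain *)

Section IidMarkovChain.
Local Open Scope classical_set_scope.
Context {R : realType} {d : measure_display} {Omega : measurableType d}.
Variables (P : probability Omega R) (B S : finType) (step : S -> B -> S).
Variable Q : S -> S -> R.
Hypothesis QE : forall x y, Q x y = (\sum_c (step x c == y))%N%:R / #|B|%:R.

Lemma iid_markov_chain (U : nat -> Omega -> B) (x0 : S) : iid_uniform P U ->
  markov_chain P Q (fun t w => foldl step x0 (prefix U t w)).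
Proof.
move=> iidU; split=> [t y|t x y].
  rewrite (_ : _ @^-1` _ = [set w | foldl step x0 (prefix U t w) == y]).
    exact: (prefix_event (fun b : t.-tuple B => foldl step x0 b == y) iidU).1.
  by apply/seteqP; split => w /= /eqP.
pose E t (b : seq B) := [forall s : 'I_t.+1, foldl step x0 (take s b) == x s].
have prefix_take s T w : (s <= T)%N -> take s (prefix U T w) = prefix U s w :> seq B.
  by move=> sT; rewrite /prefix /= /mkseq -map_take take_iota (minn_idPl sT).
have -> : history (fun t w => foldl step x0 (prefix U t w)) x t =
    [set w | E t (prefix U t w)].
  apply/seteqP; split => w /= => [h|/forallP h s st].
    apply/forallP => s; have st : (s <= t)%N by rewrite -ltnS.
    by rewrite prefix_take //; apply/eqP/h.
  by have /eqP := h (Ordinal (st : (s < t.+1)%N)); rewrite prefix_take.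
pose E' b := E t (take t b) && (foldl step x0 b == y).
have -> : [set w | E t (prefix U t w)] `&`
    (fun w => foldl step x0 (prefix U t.+1 w)) @^-1` [set y] =
    [set w | E' (prefix U t.+1 w)].
  apply/seteqP; split => w.
    by case=> Et Xy; apply/andP; split; [rewrite prefix_take|apply/eqP].
  by case/andP; rewrite prefix_take // => Et /eqP.
rewrite (prefix_event (fun b : t.+1.-tuple B => E' b) iidU).2.
rewrite (prefix_event (fun b : t.-tuple B => E t b) iidU).2 lte_fin.
set h := (\sum_(b : t.-tuple B) E t b)%N => h0.
(* All [h] prefixes compatible with the history end in [x t], so each has the same number of
   extensions reaching [y]. *)
have -> : (\sum_(b : t.+1.-tuple B) E' b = h * \sum_c (step (x t) c == y))%N.
  rewrite (sum_tuple_rcons _ (fun b => E' b : nat)) big_distrl /=.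
  apply: eq_bigr => b _; rewrite big_distrr /=; apply: eq_bigr => c _.
  rewrite /E' -cats1 takel_cat ?size_tuple // take_oversize ?size_tuple // cats1.
  case: (boolP (E t b)) => //= /forallP/(_ ord_max) /=.
  by rewrite take_oversize ?size_tuple // foldl_rcons => /eqP->; rewrite mul1n.
rewrite /= QE expnSr !natrM.
have [hR NR] : h%:R != 0 :> R /\ (#|B| ^ t)%:R != 0 :> R.
  move: h0; split; apply: contraTneq h0 => ->; first by rewrite mul0r ltxx.
  by rewrite invr0 mulr0 ltxx.
rewrite invfM; set k := (\sum_c _)%N; set a := #|B|%:R^-1.
by field; rewrite hR NR.
Qed.

End IidMarkovChain.

(** * Permuting the first block of innovations *)

Section Relabel.
Local Open Scope classical_set_scope.
Context {R : realType} {d : measure_display} {Omega : measurableType d}.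
Variables (P : probability Omega R) (B : finType) (t0 : nat).
Variable phi : {perm t0.-tuple B}.
Implicit Types (U : nat -> Omega -> B).

(** The default of [nth] is never reached, since [s < t0]. *)
Definition relabel U s w : B :=
  if (s < t0)%N then nth (U s w) (phi (prefix U t0 w)) s else U s w.

Lemma mkseq_add (A : Type) (u : nat -> A) m k :
  mkseq u (m + k) = mkseq u m ++ mkseq (fun s => u (m + s)%N) k.
Proof.
by rewrite /mkseq iotaD map_cat add0n -[X in iota X k]addn0 iotaDl -map_comp.
Qed.

Lemma relabel_prefix U w :
  mkseq ((relabel U)^~ w) t0 = phi (prefix U t0 w) :> seq B.
Proof.
apply: (@eq_from_nth _ (U 0%N w)); rewrite ?size_mkseq ?size_tuple // => s st.
by rewrite nth_mkseq // /relabel st; apply: set_nth_default; rewrite size_tuple.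
Qed.

Lemma count_take T k (b : T.-tuple B) :
  (\sum_(c : (T + k).-tuple B) (take T c == b) = #|B| ^ k)%N.
Proof.
elim: k => [|k IHk].
  rewrite addn0 (bigD1 b) //= take_oversize ?size_tuple // eqxx big1 // => c cb.
  by rewrite take_oversize ?size_tuple // (negbTE (cb : c != b :> seq B)).
rewrite addnS (sum_tuple_rcons _ (fun c => take T c == b : nat)).
rewrite (eq_bigr (fun c : (T + k).-tuple B => #|B| * (take T c == b)))%N => [|c _].
  by rewrite -big_distrr /= IHk expnS.
rewrite -sum_nat_const; apply: eq_bigr => e _.
by rewrite -cats1 takel_cat // size_tuple leq_addr.
Qed.

(** A block of length at least [t0] is pulled back through [phi^-1] to a single block of [U]. A
    shorter one is an event on the first [t0] innovations, whose number of tuples is unchanged by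
    [phi]. *)
Lemma relabel_iid_uniform U : (0 < #|B|)%N ->
  iid_uniform P U -> iid_uniform P (relabel U).
Proof.
move=> B0 iidU T; have [le_t0T|lt_Tt0] := leqP t0 T.
  rewrite -(subnKC le_t0T); move: (T - t0)%N => k b.
  have size_u : size (take t0 b) == t0.
    by rewrite size_takel // size_tuple leq_addr.
  pose u : t0.-tuple B := Tuple size_u.
  have size_b' : size ((phi^-1)%g u ++ drop t0 b) == (t0 + k)%N.
    by rewrite size_cat size_drop !size_tuple addKn.
  suff -> : [set w | prefix (relabel U) (t0 + k) w = b] =
      [set w | prefix U (t0 + k) w = Tuple size_b'] by exact: iidU.
  have key w : prefix (relabel U) (t0 + k) w = b <->
      prefix U (t0 + k) w = Tuple size_b'.
    have e1 : (prefix (relabel U) (t0 + k) w == b) =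
        (phi (prefix U t0 w) == u) && (mkseq (fun s => U (t0 + s)%N w) k == drop t0 b).
      rewrite -val_eqE /= mkseq_add relabel_prefix -[X in _ == X](cat_take_drop t0).
      rewrite eqseq_cat ?(eqP size_u) ?size_tuple // -[take t0 b]/(tval u).
      congr (_ && (_ == _)); apply: eq_map => s.
      by rewrite /relabel ltnNge leq_addr.
    have e2 : (prefix U (t0 + k) w == Tuple size_b') =
        (prefix U t0 w == (phi^-1)%g u)
        && (mkseq (fun s => U (t0 + s)%N w) k == drop t0 b).
      by rewrite -val_eqE /= mkseq_add eqseq_cat ?size_mkseq ?size_tuple.
    have e3 : (phi (prefix U t0 w) == u) = (prefix U t0 w == (phi^-1)%g u).
      by apply/eqP/eqP => [<-|->]; rewrite ?permK ?permKV.
    by split=> /eqP h; apply/eqP; move: h; rewrite e1 e2 e3.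
  by apply/seteqP; split => w /key.
move=> b; have e w : take T (phi (prefix U t0 w)) = prefix (relabel U) T w :> seq B.
  by rewrite -relabel_prefix /mkseq -map_take take_iota (minn_idPl (ltnW lt_Tt0)).
have -> : [set w | prefix (relabel U) T w = b] =
    [set w | take T (phi (prefix U t0 w)) == b].
  apply/seteqP; split => w; first by move=> h; rewrite /mkset e h.
  by rewrite /mkset e => /eqP/val_inj.
have [mE ->] := prefix_event (fun c => take T (phi c) == b) iidU.
split=> //; congr (_%:E).
have -> : (\sum_c (take T (phi c) == b) = #|B| ^ (t0 - T))%N.
  transitivity (\sum_(c : t0.-tuple B) (take T c == b))%N.
    by rewrite [RHS](reindex_perm phi).
  by rewrite -(count_take _ b) subnKC // ltnW.
rewrite -[in X in _ / X](subnK (ltnW lt_Tt0)) expnD natrM invfM mulVKf //.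
by rewrite pnatr_eq0 -lt0n expn_gt0 B0.
Qed.

End Relabel.

(** * Independent uniform letters from the digits of a uniform real *)

Section Digits.
Local Open Scope classical_set_scope.
Variable R : realType.

Definition unit_lebesgue : set (measurableTypeR R) -> \bar R :=
  mrestr lebesgue_measure (measurable_itv `[0, 1[%R).

HB.instance Definition _ := Measure.copy unit_lebesgue
  (mrestr lebesgue_measure (measurable_itv `[0, 1[%R)).

Lemma unit_lebesgue_setT : unit_lebesgue setT = 1%E.
Proof.
by rewrite /unit_lebesgue /mrestr setTI lebesgue_measure_itv /= lte_fin ltr01 oppr0 adde0.
Qed.

HB.instance Definition _ :=
  Measure_isProbability.Build _ _ _ unit_lebesgue unit_lebesgue_setT.

(** The sample space is all of [R]; points outside the unit interval form a null set and are sent to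
    0. *)
Definition clamp01 (w : R) : R := if w \in `[0, 1[%R then w else 0.

Lemma clamp01_itv w : 0 <= clamp01 w < 1.
Proof.
rewrite /clamp01; case: ifPn => [|_]; last by rewrite lexx ltr01.
by rewrite in_itv.
Qed.

Lemma truncn_divn (N : nat) (x : R) : (0 < N)%N -> 0 <= x ->
  (Num.truncn (N%:R * x) %/ N)%N = Num.truncn x.
Proof.
move=> N0 x0; apply/esym/truncn_def.
have Nx0 : 0 <= N%:R * x by rewrite mulr_ge0.
have NR : 0 < N%:R :> R by rewrite ltr0n.
rewrite -(ler_pM2l NR) -(ltr_pM2l NR) -!natrM.
rewrite -truncn_ge_nat // -truncn_lt_nat // mulnC leq_divM /=.
by rewrite mulnC ltn_ceil.
Qed.

Lemma truncn_clamp01_event (N m : nat) : (m < N)%N ->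
  measurable [set w | Num.truncn (N%:R * clamp01 w) = m] /\
  unit_lebesgue [set w | Num.truncn (N%:R * clamp01 w) = m] = (N%:R^-1)%:E.
Proof.
move=> mN; have NR : 0 < N%:R :> R by rewrite ltr0n (leq_ltn_trans _ mN).
pose I := `[m%:R / N%:R, m.+1%:R / N%:R[%R : interval R.
have IE (w : R) : 0 <= w -> Num.truncn (N%:R * w) = m <-> w \in I.
  move=> w0; rewrite in_itv /= ler_pdivrMr // ltr_pdivlMr // mulrC.
  by rewrite -truncn_eq ?mulr_ge0 //; split => /eqP.
have I01 w : w \in I -> w \in `[0, 1[%R.
  rewrite !in_itv /= => /andP[mw wm]; rewrite (le_trans _ mw) ?divr_ge0 //=.
  by rewrite (lt_le_trans wm) // ler_pdivrMr // mul1r ler_nat.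
(* Points outside the unit interval are clamped to 0 and so fall in the cell [m = 0]. *)
have e : [set w | Num.truncn (N%:R * clamp01 w) = m] =
    [set` I] `|` (if m == 0%N then ~` [set` `[0, 1[%R] else set0).
  apply/seteqP; split => w /=; rewrite /clamp01.
    case: ifPn => w01 tr; first left.
      by apply/IE; move: w01; rewrite ?in_itv //= => /andP[].
    right; rewrite -tr mulr0 truncn0 eqxx; exact/negP.
  case=> [wI|].
    by rewrite I01 //; apply/IE => //; move: (I01 _ wI); rewrite in_itv => /andP[].
  case: eqP => // -> /negP; rewrite /= => /negbTE->.
  by rewrite mulr0 truncn0.
split.
  rewrite e; apply: measurableU => //; case: ifP => // _; exact: measurableC.
rewrite /unit_lebesgue /mrestr.
have -> : [set w | Num.truncn (N%:R * clamp01 w) = m] `&` [set` `[0, 1[%R] = [set` I].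
  rewrite e setIUl; apply/seteqP; split => w /=.
    by case=> -[] //; case: ifP => // _ /= h /h.
  by move=> wI; left; split => //; exact: I01.
rewrite lebesgue_measure_itv /= lte_fin ltr_pM2r ?invr_gt0 // ltr_nat ltnSn.
by rewrite -EFinB -mulrBl -natr1 addrAC subrr add0r mul1r.
Qed.

Lemma exists_iid_uniform (B : finType) : (0 < #|B|)%N ->
  exists U : nat -> measurableTypeR R -> B, iid_uniform unit_lebesgue U.
Proof.
move=> B0; pose N := #|B|.
(* [D T w] is the integer written by the first [T] base-[N] digits of [w], so letter [s] is the last
   digit of [D s.+1]; [code] reads a word as such an integer. *)
pose D T w := Num.truncn ((N ^ T)%:R * clamp01 w).
have D_lt w s : (D s w %% N < #|B|)%N by rewrite ltn_mod.
pose U s w : B := enum_val (Ordinal (D_lt w s.+1)); exists U.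
pose code (b : seq B) := foldl (fun m c => m * N + enum_rank c)%N 0%N b.
have codeE w (b : seq B) : (mkseq (U^~ w) (size b) == b) = (D (size b) w == code b).
  elim/last_ind: b => [|b c IHb].
    rewrite /= /D expn0 mul1r eqxx; apply/esym/eqP/truncn_def.
    exact: clamp01_itv.
  have /andP[w0 w1] := clamp01_itv w.
  have Ddiv : (D (size b).+1 w %/ N = D (size b) w)%N.
    by rewrite /D expnS natrM -mulrA truncn_divn // mulr_ge0.
  rewrite size_rcons mkseqS eqseq_rcons IHb /code foldl_rcons -/(code b).
  rewrite (divn_eq (D (size b).+1 w) N) Ddiv.
  have -> : (U (size b) w == c) = (D (size b).+1 w %% N == enum_rank c)%N.
    rewrite -(inj_eq enum_rank_inj) /U enum_valK; exact: val_eqE.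
  apply/andP/eqP => [[/eqP-> /eqP->] //|h]; split; apply/eqP.
    have /(congr1 (divn^~ N)) := h.
    rewrite !divnMDl // !divn_small ?ltn_mod ?addn0 //; exact: ltn_ord.
  have /(congr1 (modn^~ N)) := h.
  by rewrite !modnMDl modn_mod [(enum_rank c %% N)%N]modn_small //; exact: ltn_ord.
have code_lt (b : seq B) : (code b < N ^ size b)%N.
  elim/last_ind: b => [|b c IHb]; first by rewrite expn0.
  rewrite size_rcons /code foldl_rcons -/(code b) expnSr.
  apply: (@leq_trans ((code b).+1 * N)); last by rewrite leq_mul2r IHb orbT.
  by rewrite mulSnr ltn_add2l; exact: ltn_ord.
move=> T b.
have -> : [set w | prefix U T w = b] = [set w | D T w = code b].
  apply/seteqP; split => w; rewrite /mkset.
    move=> <-; apply/eqP.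
    by rewrite -[T in D T](size_tuple (prefix U T w)) -codeE size_tuple.
  move/eqP; rewrite -[T in D T](size_tuple b) -codeE size_tuple => /eqP h.
  exact: val_inj.
by apply: truncn_clamp01_event; rewrite -[X in (_ ^ X)%N](size_tuple b).
Qed.

End Digits.

(** * The coupling *)

Section RelabelCoupling.
Local Open Scope classical_set_scope.
Variables (R : realType) (S B : finType) (step : S -> B -> S) (Q : S -> S -> R).
Hypothesis QE : forall x y, Q x y = (\sum_c (step x c == y))%N%:R / #|B|%:R.
Hypothesis B0 : (0 < #|B|)%N.
Variables (d : measure_display) (Omega : measurableType d).
Variables (P : probability Omega R) (U : nat -> Omega -> B).
Hypothesis iidU : iid_uniform P U.
Variables (t0 : nat) (phi : S -> S -> {perm t0.-tuple B}).

Definition disagree x y (b : t0.-tuple B) : bool :=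
  foldl step x b != foldl step y (phi x y b).

(** Meetings before [t0] are ignored, as the chains may separate again; from [t0] on they share
    their innovations, so agreement at [t0] persists. *)
Definition relabel_time x y w : option nat :=
  if disagree x y (prefix U t0 w) then None else Some t0.

Definition relabel_coupling x y : coupling Q :=
  Coupling (iid_markov_chain QE x iidU)
    (iid_markov_chain QE y (relabel_iid_uniform (phi x y) B0 iidU)).

Lemma relabel_coupling_start x y : started_at (relabel_coupling x y) x y.
Proof.
by split; rewrite /= -(probability_setT P); congr (P _);
  apply/seteqP; split.
Qed.

Lemma after_relabel_time x y t : after (relabel_time x y) t =
  [set w | (t < t0)%N || disagree x y (prefix U t0 w)].
Proof.
apply/seteqP; split => w; rewrite /after /mkset /relabel_time;
  by case: (disagree _ _ _); rewrite ?orbT ?orbF.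
Qed.

Lemma relabel_meeting_time x y :
  meeting_time (K := relabel_coupling x y) (relabel_time x y).
Proof.
split=> [t|w s t].
  rewrite after_relabel_time.
  exact: (prefix_event (fun b => (t < t0)%N || disagree x y b) iidU).1.
rewrite /relabel_time; case: ifPn => // /negPn /eqP eq0 [<-] le_t.
rewrite /= -(subnKC le_t) !mkseq_add !foldl_cat eq0 relabel_prefix.
by congr foldl; apply: eq_map => k; rewrite /relabel ltnNge leq_addr.
Qed.

Definition relabel_argument : coupling_argument Q :=
  CouplingArgument relabel_coupling_start relabel_meeting_time.

Lemma relabel_argument_prob x y t :
  fine (cpl_prob (arg_cpl relabel_argument x y)
    (after (@arg_time _ _ _ relabel_argument x y) t)) =
  if (t < t0)%N then 1
  else (\sum_(b : t0.-tuple B) disagree x y b)%N%:R / (#|B| ^ t0)%:R.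
Proof.
rewrite /= after_relabel_time; case: ifP => tt0.
  rewrite (_ : [set w | _] = setT) ?probability_setT //.
  by apply/seteqP; split.
by rewrite (prefix_event (fun b => false || disagree x y b) iidU).2.
Qed.

Lemma relabel_argument_bound t e : 0 <= e -> (t0 <= t)%N ->
  (forall x y, (\sum_(b : t0.-tuple B) disagree x y b)%N%:R / (#|B| ^ t0)%:R <= e) ->
  coupling_bound relabel_argument t <= e.
Proof.
move=> e0 t0t le_e; apply: bigmax_le => // x _; apply: bigmax_le => // y _.
by rewrite relabel_argument_prob ltnNge t0t; exact: le_e.
Qed.

(** The coupling inequality for this argument, obtained by counting sequences: before [t0] the bound
    is 1, and from [t0] on the distance is at most its value at [t0], which the disagreeing fraction
    bounds. *)
Lemma worst_tv_le_coupling_bound t : (forall c, injective (step^~ c)) ->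
  worst_tv Q (fun=> #|S|%:R^-1) t <= coupling_bound relabel_argument t.
Proof.
move=> injs; apply: bigmax_le => [|x _].
  by rewrite /coupling_bound; elim/big_rec: _ => // x e _ e0; rewrite le_max e0 orbT.
apply: tv_dist_uniform_le => [z|y].
  exact: sum_kernel_pow_col.
apply: le_trans (le_bigmax _ _ x); apply: le_trans (le_bigmax _ _ y).
rewrite relabel_argument_prob; case: ltnP => [_|t0t].
  (* Any permutation shows that the distance is at most 1; the identity is taken. *)
  apply: le_trans (tv_dist_kernel_pow_le QE 1%g x y) _ => //.
  rewrite ler_pdivrMr ?ltr0n ?expn_gt0 ?B0 // mul1r ler_nat -card_tuple -sum1_card.
  by apply: leq_sum => b _; case: (_ != _).
apply: le_trans (tv_dist_kernel_pow_antitone QE x y B0 t0t) _.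
exact: tv_dist_kernel_pow_le.
Qed.

End RelabelCoupling.

(** * Application to the random transposition walk *)

Lemma transposition_kernelE (R : realType) (n : nat) (x y : 'S_n) :
  transposition_kernel R x y =
    (\sum_c (shuffle x c == y))%N%:R / #|{: 'I_n * 'I_n}|%:R.
Proof.
rewrite /transposition_kernel card_prod !card_ord mulnn natr_sum mulr_suml.
rewrite pair_bigA; apply: eq_bigr => -[u v] _.
by rewrite eq_sym.
Qed.

Theorem theorem1 (R : realType) :
  exists C : R, forall n : nat, (0 < n)%N ->
    exists A : coupling_argument (@transposition_kernel R n),
      [/\ forall t : nat,
            worst_tv (@transposition_kernel R n) (@uniform_perm R n) t
              <= coupling_bound A t,
          exists t : nat,
            t%:R <= C * n%:R * ln n%:R /\ coupling_bound A t <= 4%:R^-1 &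
          exists tau : nat,
            is_mixing_time (@transposition_kernel R n) (@uniform_perm R n) tau
            /\ tau%:R <= C * n%:R * ln n%:R].
Proof.
exists 26 => n n0.
have [t0 [t0_le unmarked_le]] := full_marking_time R (Ordinal n0).
have B0 : (0 < #|{: 'I_n * 'I_n}|)%N by rewrite card_prod card_ord muln_gt0 n0.
have [U iidU] := exists_iid_uniform R B0.
pose phi x y := sval (cid (shuffle_matching t0 (Ordinal n0) x y)).
pose A := relabel_argument (@transposition_kernelE R n) B0 iidU phi; exists A.
have tvA t : worst_tv (@transposition_kernel R n) (@uniform_perm R n) t
    <= coupling_bound A t.
  by apply: worst_tv_le_coupling_bound => c x y; exact: mulIg.
have A_le : coupling_bound A t0 <= 4%:R^-1.
  apply: relabel_argument_bound => // x y.
  have le_xy := svalP (cid (shuffle_matching t0 (Ordinal n0) x y)).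
  rewrite card_prod !card_ord mulnn ler_pdivrMr ?ltr0n ?expn_gt0 ?n0 //.
  rewrite ler_pdivlMl // -natrM ler_nat.
  by apply: leq_trans unmarked_le; rewrite leq_mul2l /=.
split => //; first by exists t0.
(* The set of times at distance at most 1/4 contains [t0], so its minimum, the mixing time, exists
   and is at most [t0]. *)
have ex : exists t, worst_tv (@transposition_kernel R n) (@uniform_perm R n) t <= 4%:R^-1.
  by exists t0; exact: le_trans A_le.
exists (ex_minn ex); case: ex_minnP => tau tau_le tau_min; split; first by [].
by apply: le_trans t0_le; rewrite ler_nat tau_min // (le_trans (tvA t0)).
Qed.
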